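(* Let $X$ be any compact metric space. Then the trivial $\mathbb Z$-system $(X,\mathrm{id}_X)$ is subshift/subshift.
   Context: A $\mathbb Z$-subshift is a closed shift-invariant subset of $\Sigma^{\mathbb Z}$, $\Sigma$ a finite alphabet. $(\Sigma^2)^{\mathbb Z}$ is identified with $\Sigma^{\mathbb Z}\times\Sigma^{\mathbb Z}$. A dynamical $\mathbb Z$-system is subshift/subshift if it is conjugate (equivariantly homeomorphic) to $Y/Z$ for some subshifts $Y\subset\Sigma^{\mathbb Z}$ and $Z\subset(\Sigma^2)^{\mathbb Z}$ such that $Z\cap Y^2$ is an equivalence relation on $Y$, where $Y/Z$ is the topological quotient $Y/(Z\cap Y^2)$ with the homeomorphism induced by the shift. *)

(* Defs.v *)
From HB Require Import structures.
From mathcomp Require Import all_boot all_order all_algebra generic_quotient.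
From mathcomp Require Import all_classical all_reals all_analysis.

Set Implicit Arguments.
Unset Strict Implicit.
Unset Printing Implicit Defensive.

Import GRing.Theory.
Local Open Scope classical_set_scope.
Local Open Scope ring_scope.
Local Open Scope quotient_scope.

Definition homeomorphism (S T : topologicalType) (f : S -> T) : Prop :=
  exists g : T -> S, [/\ cancel f g, cancel g f, continuous f & continuous g].

Record zsystem := ZSystem {
  zspace :> topologicalType;
  zmap : zspace -> zspace;
  zmap_homeo : homeomorphism zmap }.

Definition conjugate (A B : zsystem) : Prop :=
  exists h : A -> B, homeomorphism h /\ forall x, h (zmap x) = zmap (h x).

Lemma homeomorphism_id (X : topologicalType) : homeomorphism (@id X).
Proof. by exists id; split => // x; exact: cvg_id. Qed.

Definition trivial_zsystem (X : topologicalType) : zsystem :=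
  ZSystem (homeomorphism_id X).

(* A finType carries no topology by itself: [discrete_topology] makes the
   alphabet discrete and [{ptws _ -> _}] is the product topology. *)
Definition config (S : finType) := {ptws int -> discrete_topology S}.

Definition shift (S : finType) (x : config S) : config S := fun i => x (i + 1).
Definition unshift (S : finType) (x : config S) : config S :=
  fun i => x (i - 1).

Definition subshift (S : finType) (Y : set (config S)) : Prop :=
  closed Y /\ @shift S @` Y = Y.

(* The identification of pairs of configurations over S with configurations
   over S * S. *)
Definition zip_config (S : finType) (x y : config S) : config (S * S)%type :=
  fun i => (x i, y i).

(* Z :&: Y^2, as a relation on the subtype of points of Y. *)
Definition restr_rel (S : finType) (Y : set (config S))
    (Z : set (config (S * S)%type)) : rel Y :=
  fun a b => `[< Z (zip_config (\val a) (\val b)) >].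
Arguments restr_rel {S} Y Z _ _.

Definition is_equivalence (T : Type) (e : rel T) : Prop :=
  [/\ reflexive e, symmetric e & transitive e].

Lemma shiftK (S : finType) : cancel (@shift S) (@unshift S).
Proof. by move=> x; apply/funext => i; rewrite /unshift /shift subrK. Qed.

Lemma unshiftK (S : finType) : cancel (@unshift S) (@shift S).
Proof. by move=> x; apply/funext => i; rewrite /unshift /shift addrK. Qed.

Lemma reindex_continuous (I : eqType) (T : topologicalType) (f : I -> I) :
  continuous ((fun x i => x (f i)) : {ptws I -> T} -> {ptws I -> T}).
Proof.
move=> x; have Fx := nbhs_filter x.
apply/cvg_sup => i U [_ [[W oW <-] /= Wx]] /filterS; apply.
apply: (@proj_continuous I (fun=> T) (f i) x).
exact: open_nbhs_nbhs.
Qed.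

Lemma shift_continuous (S : finType) : continuous (@shift S).
Proof. exact: (@reindex_continuous int (discrete_topology S)). Qed.

Lemma unshift_continuous (S : finType) : continuous (@unshift S).
Proof. exact: (@reindex_continuous int (discrete_topology S)). Qed.

Lemma shift_mem (S : finType) (Y : set (config S)) (x : config S) :
  subshift Y -> x \in Y -> shift x \in Y.
Proof. by move=> [_ YE] /set_mem Yx; apply/mem_set; rewrite -YE; exists x. Qed.

Lemma unshift_mem (S : finType) (Y : set (config S)) (x : config S) :
  subshift Y -> x \in Y -> unshift x \in Y.
Proof.
move=> [_ YE] /set_mem; rewrite -{1}YE => -[y Yy <-].
by rewrite shiftK; exact: mem_set.
Qed.

Section Quotient.
Variables (S : finType) (Y : set (config S)) (Z : set (config (S * S)%type)).
Hypotheses (subY : subshift Y) (subZ : subshift Z).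
Hypothesis eqZ : is_equivalence (restr_rel Y Z).

Definition restr_equiv : equiv_rel Y :=
  let: And3 er es et := eqZ in EquivRel (restr_rel Y Z) er es et.

Definition quotient_space : topologicalType :=
  quotient_topology {eq_quot restr_equiv}.

Definition quotient_proj (a : Y) : quotient_space :=
  \pi_(quotient_topology {eq_quot restr_equiv}) a.

Definition shift_sub (a : Y) : Y :=
  exist (fun x => x \in Y) (shift (\val a)) (shift_mem subY (valP a)).
Definition unshift_sub (a : Y) : Y :=
  exist (fun x => x \in Y) (unshift (\val a)) (unshift_mem subY (valP a)).

(* The map induced by the shift, defined through representatives; it does not
   depend on them by [quotient_shift_proj]. *)
Definition quotient_shift (q : quotient_space) : quotient_space :=
  quotient_proj (shift_sub
    (repr (q : quotient_topology {eq_quot restr_equiv}))).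
Definition quotient_unshift (q : quotient_space) : quotient_space :=
  quotient_proj (unshift_sub
    (repr (q : quotient_topology {eq_quot restr_equiv}))).

Lemma restr_equivE a b : restr_equiv a b = restr_rel Y Z a b.
Proof. by rewrite /restr_equiv; case: eqZ. Qed.

Lemma quotient_projP a b :
  quotient_proj a = quotient_proj b <-> Z (zip_config (\val a) (\val b)).
Proof.
have piE : (quotient_proj a = quotient_proj b) <-> restr_rel Y Z a b.
  by rewrite -restr_equivE -eqmodE; split=> [?|/eqP]; [exact/eqP|exact].
by apply: (iff_trans piE); split=> [/asboolP|Zab]; [exact|exact: asboolT].
Qed.

Lemma quotient_reprK (q : quotient_space) :
  quotient_proj (repr (q : quotient_topology {eq_quot restr_equiv})) = q.
Proof. exact: (@reprK _ (quotient_topology {eq_quot restr_equiv})). Qed.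

Lemma quotient_shift_proj a :
  quotient_shift (quotient_proj a) = quotient_proj (shift_sub a).
Proof.
apply/quotient_projP; set b := repr _.
have /quotient_projP Zba : quotient_proj b = quotient_proj a.
  exact: quotient_reprK.
exact: set_mem (shift_mem subZ (mem_set Zba)).
Qed.

Lemma quotient_unshift_proj a :
  quotient_unshift (quotient_proj a) = quotient_proj (unshift_sub a).
Proof.
apply/quotient_projP; set b := repr _.
have /quotient_projP Zba : quotient_proj b = quotient_proj a.
  exact: quotient_reprK.
exact: set_mem (unshift_mem subZ (mem_set Zba)).
Qed.

Lemma shift_sub_continuous : continuous shift_sub.
Proof.
apply: (@continuous_comp_initial Y Y (config S) (@set_val _ Y) shift_sub) => a.
apply: (@continuous_comp Y _ _ (@set_val _ Y) (@shift S)).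
  exact: initial_continuous.
exact: shift_continuous.
Qed.

Lemma unshift_sub_continuous : continuous unshift_sub.
Proof.
apply: (@continuous_comp_initial Y Y (config S) (@set_val _ Y) unshift_sub) => a.
apply: (@continuous_comp Y _ _ (@set_val _ Y) (@unshift S)).
  exact: initial_continuous.
exact: unshift_continuous.
Qed.

Lemma quotient_proj_continuous : continuous quotient_proj.
Proof. exact: pi_continuous. Qed.

Lemma quotient_shift_homeo : homeomorphism quotient_shift.
Proof.
exists quotient_unshift; split.
- move=> q; rewrite -(quotient_reprK q) quotient_shift_proj.
  rewrite quotient_unshift_proj; congr quotient_proj.
  by apply: val_inj; exact: shiftK.
- move=> q; rewrite -(quotient_reprK q) quotient_unshift_proj.
  rewrite quotient_shift_proj; congr quotient_proj.
  by apply: val_inj; exact: unshiftK.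
- apply/quotient_continuous; rewrite (_ : _ \o _ = quotient_proj \o shift_sub).
    move=> a; apply: continuous_comp; first exact: shift_sub_continuous.
    exact: quotient_proj_continuous.
  by apply/funext => a /=; exact: quotient_shift_proj.
- apply/quotient_continuous.
  rewrite (_ : _ \o _ = quotient_proj \o unshift_sub).
    move=> a; apply: continuous_comp; first exact: unshift_sub_continuous.
    exact: quotient_proj_continuous.
  by apply/funext => a /=; exact: quotient_unshift_proj.
Qed.

Definition quotient_zsystem : zsystem := ZSystem quotient_shift_homeo.

End Quotient.

Definition subshift_over_subshift (A : zsystem) : Prop :=
  exists (S : finType) (Y : set (config S)) (Z : set (config (S * S)%type))
    (subY : subshift Y) (subZ : subshift Z)
    (eqZ : is_equivalence (restr_rel Y Z)),
    conjugate A (quotient_zsystem subY subZ eqZ).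

(* Main.v *)
From HB Require Import structures.
Require Import Defs.
From mathcomp Require Import all_boot all_order all_algebra.
From mathcomp Require Import generic_quotient.
From mathcomp Require Import all_classical all_reals all_analysis.
From mathcomp Require Import zify lra.

(** If a closed relation [P] between a compact space [X] and configurations is
    shift-invariant, and every point of [X] has at least one code while every
    configuration codes at most one point, then the coded configurations form
    a subshift [Y], decoding is a continuous shift-invariant surjection from
    [Y] to [X], and the pairs of configurations with the same decoding form a
    subshift [Z].  The quotient [Y/Z] is then [X] with the identity map
    ([trivial_subshift_over_subshift]); closedness of all the sets involved
    comes from projecting closed sets along compact factors
    ([closed_exists_compact]).

    It remains to code the points of a compact metric space.  A nonempty one
    is a continuous image of the Cantor space, so it suffices to code binary
    sequences [z] by binary configurations [x] in a shift-invariant way.  The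
    code prescribes the density of ones in [x] to be the real number with
    base 4 digits [2 z_0, 2 z_1, ...]: every window of length [4 ^ k] of [x]
    has [d_k] or [d_k + 1] ones, where [d_k] is the integer whose base 4
    digits are the first [k] ones ([has_density]).  Each such condition bears
    on finitely many coordinates, so the relation is closed.  The digits being
    even, distinct values of [d_k] with the same [d_(k-1)] differ by 2, so [x]
    determines [z] ([has_density_inj]).  Sturmian configurations, the
    increments of the sequence of floors of [i * th], realize every density
    [th] ([has_density_exists]). *)

Set Implicit Arguments.
Unset Strict Implicit.
Unset Printing Implicit Defensive.

Import Order.TTheory GRing.Theory Num.Theory.
Local Open Scope classical_set_scope.
Local Open Scope ring_scope.
Local Open Scope quotient_scope.

(** * Closed relations and compactness *)

Lemma closed_exists_compact (A B : topologicalType) (P : A -> B -> Prop) :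
  compact [set: B] -> closed [set p : A * B | P p.1 p.2] ->
  closed [set a | exists b, P a b].
Proof.
move=> /compact_near_coveringP cB; rewrite -openC openE => oP.
rewrite -openC openE => a /= /forallNP nPa.
have /filterS : \forall a' \near a, [set: B] `<=` (fun b => ~ P a' b).
  apply: cB => b _.
  have /oP : (~` [set p : A * B | P p.1 p.2]) (a, b) by exact: nPa.
  rewrite /interior => -[[U V] /= [aU bV] UVP].
  by exists (V, U) => // -[b' a'] /= [? ?]; apply: (UVP (a', b')).
by apply => a' nP [b Pab]; exact: (nP b).
Qed.

Lemma continuous_pair (A B C : topologicalType) (f : A -> B) (g : A -> C) :
  continuous f -> continuous g -> continuous (fun a => (f a, g a)).
Proof. by move=> cf cg a; apply: cvg_pair; [exact: cf|exact: cg]. Qed.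

Lemma closed_rel_preimage (A B C : topologicalType) (P : B -> C -> Prop)
    (f : A -> B) (g : A -> C) :
  continuous f -> continuous g -> closed [set p : B * C | P p.1 p.2] ->
  closed [set a | P (f a) (g a)].
Proof.
by move=> cf cg; have /continuous_closedP := continuous_pair cf cg; apply.
Qed.

Lemma fst_continuous (A B : topologicalType) : continuous (@fst A B).
Proof. by move=> p; exact: cvg_fst. Qed.

Lemma snd_continuous (A B : topologicalType) : continuous (@snd A B).
Proof. by move=> p; exact: cvg_snd. Qed.

Lemma closed_exists_common (A B T : topologicalType) (P : B -> A -> Prop)
    (f g : T -> A) :
  compact [set: B] -> continuous f -> continuous g ->
  closed [set p : B * A | P p.1 p.2] ->
  closed [set w | exists b, P b (f w) /\ P b (g w)].
Proof.
move=> cB cf cg clP; apply: closed_exists_compact => //.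
have c1 (h : T -> A) : continuous h -> continuous (fun p : T * B => h p.1).
  move=> ch p; apply: (@continuous_comp _ _ _ fst h); last exact: ch.
  exact: fst_continuous.
apply: closedI; apply: closed_rel_preimage clP;
  by [exact: snd_continuous|exact: c1].
Qed.

Lemma closed_diagonal (T : topologicalType) :
  hausdorff_space T -> closed [set p : T * T | p.1 = p.2].
Proof.
move=> hT [s t] clst; apply: hT => U V Us Vt.
have [|[u v] [/= <- [/= Uu Vu]]] := clst (U `*` V); first by exists (U, V).
by exists u.
Qed.

(** * Spaces of configurations *)

Lemma nbhs_coordinate (S : finType) (x : config S) (i : int) :
  \forall y \near x, y i = x i.
Proof.
apply: (@proj_continuous int (fun=> discrete_topology S) i x [set x i]).
by rewrite nbhs_principalE; exact/principal_filterP.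
Qed.

Lemma map_config_continuous (S T : finType) (f : S -> T) :
  continuous ((fun x i => f (x i)) : config S -> config T).
Proof.
move=> x; have Fx := nbhs_filter x.
apply/cvg_sup => i U [_ [[W oW <-] /= Wx]] /filterS; apply.
by apply: filterS (nbhs_coordinate x i) => y yx; rewrite /= yx.
Qed.

Lemma config_compact (S : finType) : compact [set: config S].
Proof.
have := @tychonoff int (fun=> discrete_topology S) (fun=> setT)
  (fun=> @finite_compact (discrete_topology S) setT (@finite_finset S setT)).
by congr compact; apply/seteqP; split.
Qed.

(** * The quotient by a shift-invariant coding *)

Section Coding.
Variables (X : topologicalType) (S : finType) (P : X -> config S -> Prop).
Hypotheses (cX : compact [set: X]) (clP : closed [set p | P p.1 p.2]).
Hypothesis exP : forall t, exists x, P t x.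
Hypothesis uniqP : forall t t' x, P t x -> P t' x -> t = t'.
Hypothesis shiftP : forall t x, P t (Defs.shift x) <-> P t x.

(** The set of configurations that code some point. *)
Definition coded : set (config S) := [set x | exists t, P t x].

(** The set of pairs of configurations that code a common point, a pair being
    seen as a configuration over [S * S]. *)
Definition same_code : set (config (S * S)%type) :=
  [set w | exists t, P t (fun i => (w i).1) /\ P t (fun i => (w i).2)].

Lemma coded_subshift : subshift coded.
Proof.
split.
  apply: closed_exists_compact => //.
  apply: closed_rel_preimage clP; last exact: fst_continuous.
  exact: snd_continuous.
apply/seteqP; split=> [_ [x [t Ptx] <-]|x [t Ptx]].
  by exists t; exact/shiftP.
exists (unshift x); last exact: unshiftK.
by exists t; apply/shiftP; rewrite unshiftK.
Qed.

Lemma same_code_subshift : subshift same_code.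
Proof.
split.
  apply: (@closed_exists_common (config S) X (config (S * S)%type)) => //.
    exact: (@map_config_continuous _ _ (@fst S S)).
  exact: (@map_config_continuous _ _ (@snd S S)).
have sE (f : S * S -> S) w : (fun i => f (Defs.shift w i)) =
    Defs.shift (fun i => f (w i) : discrete_topology S) by [].
apply/seteqP; split=> [_ [w [t [P1 P2]] <-]|w [t [P1 P2]]].
  by exists t; rewrite (sE fst) (sE snd); split; exact/shiftP.
exists (unshift w); last exact: unshiftK.
by exists t; split; apply/shiftP; rewrite -1?(sE fst) -1?(sE snd) unshiftK.
Qed.

Lemma same_code_equivalence : is_equivalence (restr_rel coded same_code).
Proof.
split.
- by move=> [x xY]; apply/asboolP; have [t Pt] := set_mem xY; exists t.
- by move=> x y; apply/asbool_equiv_eq; split=> -[t [? ?]]; exists t.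
- move=> y x z /asboolP[t [Px Py]] /asboolP[t' [Py' Pz]]; apply/asboolP.
  by exists t; split=> //; rewrite (uniqP Py Py').
Qed.

Let Q : topologicalType := quotient_space same_code_equivalence.
Let proj : coded -> Q := quotient_proj same_code_equivalence.

(* A code of [t] chosen arbitrarily: [code] is not continuous, only its
   composition with [proj] is. *)
Let code t : coded := exist (fun x => x \in coded) (sval (cid (exP t)))
  (mem_set (ex_intro _ t (svalP (cid (exP t))))).

Let decode (a : coded) : X := sval (cid (set_mem (valP a))).

Let codeP t : P t (\val (code t)).
Proof. exact: (svalP (cid (exP t))). Qed.

Let decodeP a : P (decode a) (\val a).
Proof. exact: (svalP (cid (set_mem (valP a)))). Qed.

Let decode_unique t a : P t (\val a) -> decode a = t.
Proof. exact: uniqP (decodeP a). Qed.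

Let proj_decode a b : proj a = proj b <-> decode a = decode b.
Proof.
split=> [/quotient_projP [t [Pa Pb]]|ab].
  by rewrite (decode_unique Pa) (decode_unique Pb).
apply/quotient_projP; exists (decode a); split; first exact: decodeP.
by rewrite ab; exact: decodeP.
Qed.

Let decode_continuous : continuous decode.
Proof.
apply/continuous_closedP => F clF.
pose G := [set x | exists t, P t x /\ F t].
have -> : decode @^-1` F = \val @^-1` G.
  apply/seteqP; split=> [a Fa|a [t [Pta Ft]]]; first by exists (decode a).
  by rewrite /preimage/= (decode_unique Pta).
have /continuous_closedP : continuous (\val : coded -> config S).
  exact: initial_continuous.
apply; apply: closed_exists_compact => //.
apply: (@closed_rel_preimage (config S * X)%type _ _
  (fun t x => P t x /\ F t) snd fst).
- exact: snd_continuous.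
- exact: fst_continuous.
- apply: closedI => //.
  by have /continuous_closedP := @fst_continuous X (config S); exact.
Qed.

Let proj_code_continuous : continuous (proj \o code).
Proof.
apply/continuous_closedP => F clF.
have [G clG GF] : exists2 G, closed G & \val @^-1` G = proj @^-1` F.
  have : open (proj @^-1` (~` F)).
    apply: open_comp; last by rewrite openC.
    by move=> *; exact: quotient_proj_continuous.
  move=> [G oG GF]; exists (~` G); first by rewrite closedC.
  by move/(congr1 setC): GF; rewrite -!preimage_setC setCK.
(* Whether [G] meets the codes of [t] can be tested on any of these codes. *)
have -> : (proj \o code) @^-1` F = [set t | exists x, P t x /\ G x].
  apply/seteqP; split=> [t Ft|t [x [Ptx Gx]]].
    exists (\val (code t)); split; first exact: codeP.
    by have : (\val @^-1` G) (code t) by rewrite GF.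
  have xY : x \in coded by apply: mem_set; exists t.
  pose a : coded := exist (fun x => x \in coded) x xY.
  have Fa : (proj @^-1` F) a by rewrite -GF.
  rewrite /preimage/= (_ : proj (code t) = proj a) //.
  by apply/proj_decode; rewrite !(@decode_unique t) //; exact: codeP.
apply: closed_exists_compact; first exact: config_compact.
apply: closedI => //.
by have /continuous_closedP := @snd_continuous X (config S); exact.
Qed.

Lemma trivial_subshift_over_subshift :
  subshift_over_subshift (trivial_zsystem X).
Proof.
exists S, coded, same_code, coded_subshift, same_code_subshift.
exists same_code_equivalence, (proj \o code); split.
  pose r (q : Q) : coded :=
    repr (q : quotient_topology {eq_quot restr_equiv same_code_equivalence}).
  have rK q : proj (r q) = q by exact: quotient_reprK.
  exists (decode \o r); split.
  - move=> t /=; rewrite -[RHS](decode_unique (codeP t)).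
    by apply/proj_decode; rewrite rK.
  - move=> q /=; rewrite -[RHS]rK; apply/proj_decode.
    exact: decode_unique (codeP _).
  - exact: proj_code_continuous.
  - apply/quotient_continuous.
    rewrite (_ : _ \o _ = decode); first exact: decode_continuous.
    by apply/funext => a /=; apply/proj_decode; exact: rK.
move=> t /=; rewrite (quotient_shift_proj coded_subshift same_code_subshift).
apply/proj_decode; rewrite (decode_unique (codeP t)); apply/esym/decode_unique.
by apply/shiftP; exact: codeP.
Qed.

End Coding.

(** * Coding a binary sequence by a density *)

(** The integer whose [k] base 4 digits are [2 z_0, ..., 2 z_(k-1)], most
    significant first. *)
Fixpoint digits4 (z : nat -> bool) (k : nat) : nat :=
  if k is k'.+1 then (4 * digits4 z k' + 2 * z k')%N else 0%N.

(** The number of ones of [x] in the window of length [n] starting at [m]. *)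
Definition ones (x : config bool) (m : int) (n : nat) : nat :=
  (\sum_(i < n) x (m + i%:Z)%R)%N.

(** All windows of [x] have about the density of ones whose base 4 expansion
    is given by [z].  A window of length [n] of a Sturmian configuration has
    either of two consecutive numbers of ones, hence the margin of 1. *)
Definition has_density (z : nat -> bool) (x : config bool) : Prop :=
  forall k m, (digits4 z k <= ones x m (4 ^ k) <= (digits4 z k).+1)%N.

Lemma has_density_inj z z' x : has_density z x -> has_density z' x -> z = z'.
Proof.
move=> zx z'x.
have zE k : digits4 z k = digits4 z' k -> z k = z' k.
  move=> zz'; have /= := zx k.+1 0; have /= := z'x k.+1 0.
  by rewrite zz'; case: (z k); case: (z' k) => //=; lia.
apply/funext => k; apply: (zE k).
by elim: k => //= k IH; rewrite IH (zE _ IH).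
Qed.

Lemma ones_shift x m n : ones (Defs.shift x) m n = ones x (m + 1) n.
Proof. by apply: eq_bigr => i _; rewrite /Defs.shift addrAC. Qed.

Lemma has_density_shift z x : has_density z (Defs.shift x) <-> has_density z x.
Proof.
split=> zx k m; last by rewrite ones_shift; exact: zx.
by have := zx k (m - 1); rewrite ones_shift subrK.
Qed.

Lemma near_ones (x : config bool) m n :
  \forall y \near x, ones y m n = ones x m n.
Proof.
elim: n => [|n IH]; first by near=> y; rewrite /ones !big_ord0.
near=> y; rewrite /ones !big_ord_recr/= -!/(ones _ _ _); congr (_ + _)%N.
  by near: y.
by congr nat_of_bool; near: y; exact: nbhs_coordinate.
Unshelve. all: by end_near. Qed.

Lemma near_digits4 (z : cantor_space) k :
  \forall y \near z, digits4 y k = digits4 z k.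
Proof.
elim: k => [|k IH]; first by near=> y.
have zk : nbhs z [set y : cantor_space | y k = z k].
  apply: (@proj_continuous nat (fun=> bool) k z [set z k]).
  by rewrite nbhs_principalE; exact/principal_filterP.
near=> y => /=; congr (4 * _ + 2 * _)%N; first by near: y.
by congr nat_of_bool; near: y.
Unshelve. all: by end_near. Qed.

Lemma closed_has_density :
  closed [set p : cantor_space * config bool | has_density p.1 p.2].
Proof.
move=> [z x] clzx k m /=.
have [|[z' x'] [/(_ k m) /= zx' [/= <- <-]]//] := clzx [set p |
  digits4 p.1 k = digits4 z k /\ ones p.2 m (4 ^ k) = ones x m (4 ^ k)].
by exists ([set y | digits4 y k = digits4 z k],
  [set y | ones y m (4 ^ k) = ones x m (4 ^ k)]) => //; split;
  [exact: near_digits4|exact: near_ones].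
Qed.

Lemma digits4_real (R : realType) (z : nat -> bool) : exists th : R,
  forall k, (digits4 z k)%:R <= (4 ^ k)%:R * th < (digits4 z k).+1%:R.
Proof.
have lo k j : (digits4 z k * 4 ^ j <= digits4 z (k + j))%N.
  elim: j => [|j IH]; first by rewrite expn0 muln1 addn0.
  rewrite addnS expnS mulnCA /=.
  by apply: (leq_trans _ (leq_addr _ _)); rewrite leq_pmul2l.
(* The digits are at most 2, so the tail that follows the [k] first ones is
   at most 2/3 in units of [4 ^- k]; this makes the upper bound strict. *)
have hi k j : (3 * digits4 z (k + j) + 2 <= (3 * digits4 z k + 2) * 4 ^ j)%N.
  elim: j => [|j IH]; first by rewrite expn0 muln1 addn0.
  rewrite [(k + _)%N]addnS expnS mulnCA /=.
  by move: IH; move: (_ * 4 ^ j)%N => w; case: (z (k + j)%N) => /=; lia.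
have ub k j : (3 * (4 ^ k * digits4 z j) <= (3 * digits4 z k + 2) * 4 ^ j)%N.
  case: (leqP j k) => [/subnKC <-|/ltnW/subnKC <-]; rewrite expnD.
    have := lo j (k - j)%N; set d := digits4 z (_ + _).
    by rewrite -(leq_pmul2l (expn_gt0 4 j)); lia.
  have := hi k (j - k)%N; set d := digits4 z (_ + _).
  by rewrite -(leq_pmul2l (expn_gt0 4 k)); lia.
have e0 k : 0 < (4 ^ k)%:R :> R by rewrite ltr0n expn_gt0.
pose u k : R := (digits4 z k)%:R / (4 ^ k)%:R.
have uub k : ubound (range u) (((3 * digits4 z k + 2)%:R / 3) / (4 ^ k)%:R).
  move=> _ [j _ <-]; rewrite ler_pdivlMr // mulrAC ler_pdivrMr //.
  rewrite mulrAC ler_pdivlMr // -!natrM ler_nat mulnC [(_ * 4 ^ k)%N]mulnC.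
  exact: ub.
have u0 : range u !=set0 by exists (u 0%N), 0%N.
exists (sup (range u)) => k; apply/andP; split.
  rewrite mulrC -ler_pdivrMr //; apply: sup_upper_bound; last by exists k.
  by split=> //; eexists; exact: (uub 0%N).
apply: (@le_lt_trans _ _ ((3 * digits4 z k + 2)%:R / 3)).
  by rewrite mulrC -ler_pdivlMr //; apply: ge_sup => //; exact: uub.
by rewrite ltr_pdivrMr // -natrM ltr_nat; lia.
Qed.

(** The real type only serves to build the Sturmian configuration. *)
Lemma has_density_exists (R : realType) (z : nat -> bool) :
  exists x, has_density z x.
Proof.
have [th thP] := digits4_real R z.
pose F (m : int) := Num.floor (m%:~R * th : R).
pose x : config bool := fun i => F (i + 1) != F i.
have step m n a : a%:R <= n%:R * th < a.+1%:R ->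
    (a%:Z <= F (m + n%:Z) - F m <= a.+1%:Z).
  move=> /andP[a1 a2].
  have /andP[f1 f2] := floor_itv (m%:~R * th).
  have FE : (m + n%:Z)%:~R * th = m%:~R * th + n%:R * th.
    by rewrite intrD mulrDl.
  rewrite lerBrDr lerBlDr -[X in _ && X]ltzD1.
  rewrite {2 3}/F floor_ge_int floor_lt_int FE.
  rewrite !intrD -/(F m) -!pmulrn -addn1 natrD in f1 f2 a2 *.
  by apply/andP; split; lra.
have onesE m n : (ones x m n)%:Z = F (m + n%:Z) - F m.
  elim: n => [|n IH]; first by rewrite /ones big_ord0 addr0 subrr.
  rewrite /ones big_ord_recr /= -/(ones x m n) PoszD IH.
  (* [thP 0] places [th] in [0, 1[, so [F] increases by 0 or 1. *)
  have := step (m + n%:Z) 1%N 0%N (thP 0%N).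
  rewrite /x (intS n) (addrC 1) addrA; move: (F (_ + 1)) (F (m + n%:Z)) => u v.
  move=> uv; have [->|->] : u = v \/ u = v + 1 by lia.
    by rewrite eqxx addr0.
  have -> : v + 1 != v by lia.
  by rewrite addrAC.
by exists x => k m; have := step m _ _ (thP k); rewrite -onesE.
Qed.

(** * Compact metric spaces *)

(** The Alexandroff-Hausdorff theorem for a space with a point [p] given
    outside of its structure. *)
Lemma cantor_space_onto (R : realType) (X : metricType R) (p : X) :
  compact [set: X] ->
  exists c : cantor_space -> X, continuous c /\ forall t, exists z, c z = t.
Proof.
move=> cX.
pose pX : pseudoPMetricType R :=
  HB.pack_for (pseudoPMetricType R) (X : Type) (isPointed.Build X p)
    (PseudoMetric.class X).
have [f cf] := @cantor_surj R pX cX (@metric_hausdorff R X).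
exists f; split=> // t.
by have [z _ <-] := @surj _ _ _ _ f t I; exists z.
Qed.

Theorem theorem9p3 (R : realType) (X : metricType R)
    (hX : compact [set: X]%classic) :
  subshift_over_subshift (trivial_zsystem X).
Proof.
have [[p _]|X0] := pselect (exists p : X, True); last first.
  have noX (t : X) : False by apply: X0; exists t.
  apply: (@trivial_subshift_over_subshift X bool (fun _ _ => False)) => //.
  exact: closed0.
have [c [cc c_onto]] := cantor_space_onto p hX.
apply: (@trivial_subshift_over_subshift X bool
  (fun t x => exists z : cantor_space, c z = t /\ has_density z x)) => //.
- apply: (@closed_exists_compact (X * config bool)%type cantor_space
    (fun q z => c z = q.1 /\ has_density z q.2)).
    exact: cantor_space_compact.
  have c1 (B C : topologicalType) (h : B -> C) :
      continuous h -> forall D : topologicalType, continuous (h \o @fst B D).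
    move=> ch D q; apply: continuous_comp; last exact: ch.
    exact: fst_continuous.
  apply: closedI.
    apply: (closed_rel_preimage (f := c \o snd) (g := fst \o fst)
      _ _ (closed_diagonal (@metric_hausdorff R X))).
      by move=> q; apply: continuous_comp; [exact: snd_continuous|exact: cc].
    exact: c1 (@fst_continuous _ _) _.
  apply: closed_rel_preimage closed_has_density; first exact: snd_continuous.
  exact: c1 (@snd_continuous _ _) _.
- move=> t; have [z zt] := c_onto t.
  by have [x zx] := has_density_exists R z; exists x, z.
- move=> t t' x [z [<- zx]] [z' [<- z'x]].
  by rewrite (has_density_inj zx z'x).
- by move=> t x; split=> -[z [zt zx]]; exists z; split=> //;
    exact/has_density_shift.
Qed.
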